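(* Let $n=4m$ with $m\in\mathbb{N}$, $n=2r$, $a>0$, and let $K$ be the two-periodic Kasteleyn matrix with parameters $(a,1)$ on the Aztec diamond of size $n$ (see context). Let $G(a,1,\mathtt{w},\mathtt{b})=\sum_{x\in\mathtt{W}}\sum_{y\in\mathtt{B}}K^{-1}(x,y)w_1^{x_1}w_2^{x_2}b_1^{y_1}b_2^{y_2}$. Then $$G(a,1,\mathtt{w},\mathtt{b})=\frac{d(\mathtt{w},\mathtt{b})}{c_\partial(w_1,w_2)}+\sum_{\epsilon,\delta\in\{0,1\}}\sum_{k,l\in\{0,2n\}}\sum_{(x_1,k)\in\mathtt{W}_\epsilon}\sum_{(l,y_2)\in\mathtt{B}_\delta}\frac{s_{\epsilon,k}(w_1,w_2)\,s_{\delta,l}(b_2,b_1)\,K^{-1}((x_1,k),(l,y_2))}{c_\partial(w_1,w_2)\,c_\partial(b_1,b_2)}\,w_1^{x_1}b_2^{y_2},$$ and moreover, for all admissible $x_1$ (odd, $1\le x_1\le 2n-1$) and $y_2$ (odd, $1\le y_2\le 2n-1$), $$\begin{aligned}K^{-1}((x_1,0),(0,y_2))&=L\big(a,1,\tfrac{x_1-1}{2},\tfrac{y_2-1}{2}\big),\\ K^{-1}((x_1,0),(2n,y_2))&=\mathrm{i}^{2n-1-x_1+y_2}L\big(1,a,n-\tfrac{x_1+1}{2},\tfrac{y_2-1}{2}\big),\\ K^{-1}((x_1,2n),(0,y_2))&=\mathrm{i}^{2n-1+x_1-y_2}L\big(1,a,\tfrac{x_1-1}{2},n-\tfrac{y_2+1}{2}\big),\\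 K^{-1}((x_1,2n),(2n,y_2))&=L\big(a,1,n-\tfrac{x_1+1}{2},n-\tfrac{y_2+1}{2}\big).\end{aligned}$$
   Context: $\mathrm{i}=\sqrt{-1}$. Aztec diamond of size $n$: $\mathtt{W}=\{(x_1,x_2): x_1\text{ odd},\ x_2\text{ even},\ 1\le x_1\le 2n-1,\ 0\le x_2\le 2n\}$, $\mathtt{B}=\{(x_1,x_2): x_1\text{ even},\ x_2\text{ odd},\ 0\le x_1\le 2n,\ 1\le x_2\le 2n-1\}$, $e_1=(1,1)$, $e_2=(-1,1)$. For $\epsilon\in\{0,1\}$: $\mathtt{W}_\epsilon=\{(x_1,x_2)\in\mathtt{W}:(x_1+x_2)\bmod 4=2\epsilon+1\}$, $\mathtt{B}_\epsilon=\{(x_1,x_2)\in\mathtt{B}:(x_1+x_2)\bmod4=2\epsilon+1\}$. For parameters $\alpha,\beta>0$, the two-periodic Kasteleyn matrix $K_{\alpha,\beta}$ (rows $\mathtt{B}$, columns $\mathtt{W}$) is: for $x\in\mathtt{B}_\epsilon$, $K_{\alpha,\beta}(x,x+e_1)=\alpha(1-\epsilon)+\beta\epsilon$, $K_{\alpha,\beta}(x,x+e_2)=(\alpha\epsilon+\beta(1-\epsilon))\mathrm{i}$, $K_{\alpha,\beta}(x,x-e_1)=\alpha\epsilon+\beta(1-\epsilon)$, $K_{\alpha,\beta}(x,x-e_2)=(\alpha(1-\epsilon)+\beta\epsilon)\mathrm{i}$ (when the neighbour lies in $\mathtt{W}$), and $0$ otherwise. $K=K_{a,1}$. $L(\alpha,\beta,i,j):=K_{\alpha,\beta}^{-1}((2i+1,0),(0,2j+1))$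 on the Aztec diamond of size $n$. $f_k(t)=(1-t^k)/(1-t)$. $c_\partial(r_1,r_2)=2(1+a^2)+a(r_1^2+r_1^{-2})(r_2^2+r_2^{-2})$; $s_{\epsilon,0}(r_1,r_2)=-a(r_1^{-2}r_2^{-2}+r_1^2r_2^{-2})-a\mathrm{i}r_1^2+a\mathrm{i}r_1^{-2}-2a^{2\epsilon}$; $s_{\epsilon,2n}(r_1,r_2)=r_2^{2n}\big(-a(r_1^2r_2^2+r_1^{-2}r_2^2)+a\mathrm{i}r_1^2-a\mathrm{i}r_1^{-2}-2a^{2(1-\epsilon)}\big)$. $d_{\mathrm{sides}}(\mathtt{w},\mathtt{b})=s_{0,0}(w_1,w_2)\big(a(b_1^2-\mathrm{i})w_1b_2+w_1b_2^{-1}(1-\mathrm{i}b_1^2)\big)+s_{1,0}(w_1,w_2)\big((b_1^2-\mathrm{i})w_1^3b_1^2b_2+aw_1^3b_1^2b_2^{-1}(1-\mathrm{i}b_1^2)\big)+s_{0,2n}(w_1,w_2)\big((1-\mathrm{i}b_1^2)w_1b_2^{2n-1}+aw_1b_2^{2n+1}(b_1^2-\mathrm{i})\big)+s_{1,2n}(w_1,w_2)\big(a(1-\mathrm{i}b_1^2)w_1^3b_1^2b_2^{2n-1}+w_1^3b_1^2b_2^{2n+1}(b_1^2-\mathrm{i})\big)$. $d(\mathtt{w},\mathtt{b})=f_r(w_2^4b_2^4)f_r(w_1^4b_1^4)\,b_2w_1\big(a+w_1^2b_1^2+w_2^2b_2^2(1+aw_1^2b_1^2)\big)\big(w_2^2+b_1^2-\mathrm{i}(1+w_2^2b_1^2)\big)+\big((1-\mathrm{i}w_2^2)w_1^{-1}b_2(1+aw_2^2b_2^2)+(w_2^2-\mathrm{i})w_1^{2n+1}b_1^{2n}b_2(a+w_2^2b_2^2)\big)f_r(w_2^4b_2^4)-\frac{d_{\mathrm{sides}}(\mathtt{w},\mathtt{b})}{c_\partial(b_1,b_2)}f_r(w_1^4b_1^4)$.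 *)

(* Defs.v *)
(* The complex numbers are represented by an arbitrary
   numClosedFieldType C (e.g. R[i] for the reals R); 'i is its imaginary unit. *)
From HB Require Import structures.
From mathcomp Require Import all_boot all_order all_algebra.
Set Implicit Arguments. Unset Strict Implicit. Unset Printing Implicit Defensive.
Import Order.TTheory GRing.Theory Num.Theory.
Local Open Scope ring_scope.

Section Aztec.
Variable C : numClosedFieldType.

(* Points are pairs of natural numbers (all coordinates involved are >= 0). *)
(* Enumeration of W = {(x1,x2): x1 odd in [1,2n-1], x2 even in [0,2n]}. *)
Definition Wpt (n : nat) (j : 'I_(n * n.+1)) : nat * nat :=
  (((j %/ n.+1).*2).+1, (j %% n.+1).*2)%N.
(* Enumeration of B = {(x1,x2): x1 even in [0,2n], x2 odd in [1,2n-1]}. *)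
Definition Bpt (n : nat) (i : 'I_(n * n.+1)) : nat * nat :=
  ((i %/ n).*2, ((i %% n).*2).+1)%N.

(* Entry K_{alpha,beta}(x,y) for x in B, y in W; e1 = (1,1), e2 = (-1,1);
   x in B_eps with (x1+x2) mod 4 = 2 eps + 1. *)
Definition Kent (al be : C) (x y : nat * nat) : C :=
  let e : C := (((x.1 + x.2) %% 4)%N == 3%N)%:R in
  if (y.1 == x.1.+1) && (y.2 == x.2.+1) then al * (1 - e) + be * e        (* y = x + e1 *)
  else if (y.1.+1 == x.1) && (y.2 == x.2.+1) then (al * e + be * (1 - e)) * 'i (* y = x + e2 *)
  else if (x.1 == y.1.+1) && (x.2 == y.2.+1) then al * e + be * (1 - e)    (* y = x - e1 *)
  else if (y.1 == x.1.+1) && (x.2 == y.2.+1) then (al * (1 - e) + be * e) * 'i (* y = x - e2 *)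
  else 0.

Definition Kmat (n : nat) (al be : C) : 'M[C]_(n * n.+1) :=
  \matrix_(i, j) Kent al be (Bpt i) (Wpt j).

Definition Kinv (n : nat) (al be : C) (x y : nat * nat) : C :=
  \sum_(j | Wpt j == x) \sum_(i | Bpt i == y) invmx (Kmat n al be) j i.

Definition L (n : nat) (al be : C) (i j : nat) : C :=
  Kinv n al be ((i.*2).+1, 0%N) (0%N, (j.*2).+1).

Definition G (n : nat) (a w1 w2 b1 b2 : C) : C :=
  \sum_(x in 'I_(n * n.+1)) \sum_(y in 'I_(n * n.+1))
    invmx (Kmat n a 1) x y * w1 ^+ (Wpt x).1 * w2 ^+ (Wpt x).2
      * b1 ^+ (Bpt y).1 * b2 ^+ (Bpt y).2.

(* f_k(t) = (1 - t^k)/(1 - t), as the geometric sum. *)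
Definition fgeo (k : nat) (t : C) : C := \sum_(j < k) t ^+ j.

Definition cpart (a r1 r2 : C) : C :=
  2 * (1 + a ^+ 2) + a * (r1 ^+ 2 + r1 ^- 2) * (r2 ^+ 2 + r2 ^- 2).

Definition s0 (a : C) (eps : nat) (r1 r2 : C) : C :=
  - (a * (r1 ^- 2 * r2 ^- 2 + r1 ^+ 2 * r2 ^- 2)) - a * 'i * r1 ^+ 2
  + a * 'i * r1 ^- 2 - 2 * a ^+ (2 * eps).

Definition s2n (n : nat) (a : C) (eps : nat) (r1 r2 : C) : C :=
  r2 ^+ (n.*2) * (- (a * (r1 ^+ 2 * r2 ^+ 2 + r1 ^- 2 * r2 ^+ 2)) + a * 'i * r1 ^+ 2
                   - a * 'i * r1 ^- 2 - 2 * a ^+ (2 * (1 - eps))).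

Definition sfun (n : nat) (a : C) (eps k : nat) (r1 r2 : C) : C :=
  if k == 0%N then s0 a eps r1 r2 else s2n n a eps r1 r2.

Definition dsides (n : nat) (a w1 w2 b1 b2 : C) : C :=
  s0 a 0 w1 w2 * (a * (b1 ^+ 2 - 'i) * w1 * b2 + w1 * b2 ^-1 * (1 - 'i * b1 ^+ 2))
  + s0 a 1 w1 w2 * ((b1 ^+ 2 - 'i) * w1 ^+ 3 * b1 ^+ 2 * b2
                    + a * w1 ^+ 3 * b1 ^+ 2 * b2 ^-1 * (1 - 'i * b1 ^+ 2))
  + s2n n a 0 w1 w2 * ((1 - 'i * b1 ^+ 2) * w1 * b2 ^ ((n.*2)%:Z - 1)
                       + a * w1 * b2 ^+ (n.*2).+1 * (b1 ^+ 2 - 'i))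
  + s2n n a 1 w1 w2 * (a * (1 - 'i * b1 ^+ 2) * w1 ^+ 3 * b1 ^+ 2 * b2 ^ ((n.*2)%:Z - 1)
                       + w1 ^+ 3 * b1 ^+ 2 * b2 ^+ (n.*2).+1 * (b1 ^+ 2 - 'i)).

Definition dfun (n : nat) (a w1 w2 b1 b2 : C) : C :=
  let r := n./2 in
  fgeo r (w2 ^+ 4 * b2 ^+ 4) * fgeo r (w1 ^+ 4 * b1 ^+ 4) * b2 * w1
    * (a + w1 ^+ 2 * b1 ^+ 2 + w2 ^+ 2 * b2 ^+ 2 * (1 + a * w1 ^+ 2 * b1 ^+ 2))
    * (w2 ^+ 2 + b1 ^+ 2 - 'i * (1 + w2 ^+ 2 * b1 ^+ 2))
  + ((1 - 'i * w2 ^+ 2) * w1 ^-1 * b2 * (1 + a * w2 ^+ 2 * b2 ^+ 2)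
     + (w2 ^+ 2 - 'i) * w1 ^+ (n.*2).+1 * b1 ^+ (n.*2) * b2 * (a + w2 ^+ 2 * b2 ^+ 2))
    * fgeo r (w2 ^+ 4 * b2 ^+ 4)
  - dsides n a w1 w2 b1 b2 / cpart a b1 b2 * fgeo r (w1 ^+ 4 * b1 ^+ 4).

End Aztec.

(* Main.v *)
(* Write K = K_{a,1}. Its edges split into n^2 four-cycles, on each of which K is
   a weight c in {a, 1} times [[i, 1], [1, i]], the weights alternating like a
   chessboard. Hence K^* K acts on the monomials w1^x1 w2^x2 as multiplication
   by c_partial(w1, w2), except at the boundary vertices x2 = 0 and x2 = 2n, where
   the missing neighbours leave the terms s_{eps,k}. Summation by parts against
   K K^-1 = 1 therefore turns c_partial(w) G into a geometric sum minus boundary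
   terms; the four-cycle matrix being symmetric, transposition gives the same
   for the variable b through K^-1 K = 1, and the remaining sums are geometric.
   The formulas for the boundary entries of K^-1 come from the rotation by pi
   and from the reflection x1 -> 2n - x1, which, n being even, exchanges the
   two weights and is compatible with K up to a sign gauge.
   That K is invertible (so that invmx is an inverse) is proved by induction on n
   for arbitrary positive weights: eliminating the unknowns of each four-cycle
   (urban renewal) maps the kernel into the kernel of a diamond of size n - 1. *)
Require Import Defs.
From HB Require Import structures.
From mathcomp Require Import all_boot all_order all_algebra zify ring.
Import Order.TTheory GRing.Theory Num.Theory.
Local Open Scope ring_scope.

(** * Reindexing of finite sums *)

Section SumLemmas.
Variable V : nmodType.

Lemma sum_divmod (m d : nat) (F : nat -> nat -> V) :
  \sum_(k < m * d) F (k %/ d)%N (k %% d)%N = \sum_(p < m) \sum_(q < d) F p q.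
Proof.
case: d => [|d]; first by rewrite muln0 big_ord0 big1 // => p _; rewrite big_ord0.
rewrite -(big_mkord xpredT (fun k => F (k %/ d.+1)%N (k %% d.+1)%N)) big_nat_mul.
rewrite big_mkord; apply: eq_bigr => p _.
rewrite mulSn -[X in \sum_(X <= _ < _) _]add0n big_addn addnK big_mkord.
by apply: eq_bigr => q _; rewrite addnC divnMDl // modnMDl divn_small ?modn_small ?addn0.
Qed.

Lemma sum_pairs (r : nat) (F : nat -> V) :
  \sum_(i < r.*2) F i = \sum_(j < r) (F j.*2 + F j.*2.+1).
Proof.
elim: r => [|r IH]; first by rewrite !big_ord0.
by rewrite doubleS !big_ord_recr /= IH addrA.
Qed.

Lemma sum_rev (n : nat) (F : nat -> V) : \sum_(i < n) F (n - i.+1)%N = \sum_(i < n) F i.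
Proof. by rewrite (reindex_inj rev_ord_inj); apply: eq_bigr => i _ /=; congr F; have :=
    ltn_ord i; lia. Qed.

End SumLemmas.

Lemma sum_delta (R : pzRingType) (n k : nat) (F : nat -> R) :
  \sum_(q < n) (q == k :> nat)%:R * F q = (k < n)%:R * F k.
Proof.
case: ltnP => [kn|nk]; last first.
  rewrite mul0r big1 // => q _; rewrite (_ : (_ == _) = false) ?mul0r //.
  by apply/eqP; move: (ltn_ord q); lia.
rewrite (bigD1 (Ordinal kn)) //= eqxx !mul1r big1 ?addr0 // => q.
by rewrite -val_eqE /= => /negbTE ->; rewrite mul0r.
Qed.

(** * Coordinates on the two vertex classes and the four-cycle form of K *)

Section Points.
Variables (C : numClosedFieldType) (n : nat).
Implicit Types al be : C.

Lemma Wpt_inj : injective (@Wpt n).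
Proof.
move=> j k [] /double_inj jk /double_inj mjk; apply/val_inj.
by rewrite /= (divn_eq j n.+1) (divn_eq k n.+1) jk mjk.
Qed.

Lemma Bpt_inj : injective (@Bpt n).
Proof.
move=> j k [] /double_inj jk /double_inj mjk; apply/val_inj.
by rewrite /= (divn_eq j n) (divn_eq k n) jk mjk.
Qed.

(* (p, q) labels the white vertex (2p+1, 2q) and the black vertex (2p, 2q+1). *)
Definition wh (p q : nat) : nat * nat := (p.*2.+1, q.*2).
Definition bl (s t : nat) : nat * nat := (s.*2, t.*2.+1).

Lemma sum_Wpt (V : nmodType) (F : nat * nat -> V) :
  \sum_j F (@Wpt n j) = \sum_(p < n) \sum_(q < n.+1) F (wh p q).
Proof. by rewrite -(@sum_divmod V n n.+1 (fun p q => F (wh p q))). Qed.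

Lemma sum_divmod_swap (V : nmodType) (F : nat -> nat -> V) :
  \sum_(i < n * n.+1) F (i %/ n)%N (i %% n)%N = \sum_(s < n.+1) \sum_(t < n) F s t.
Proof.
rewrite -(@sum_divmod V n.+1 n).
by rewrite -!(big_mkord xpredT (fun i => F (i %/ n)%N (i %% n)%N)) mulnC.
Qed.

Lemma sum_Bpt (V : nmodType) (F : nat * nat -> V) :
  \sum_i F (@Bpt n i) = \sum_(s < n.+1) \sum_(t < n) F (bl s t).
Proof. by rewrite -(@sum_divmod_swap V (fun s t => F (bl s t))). Qed.

Lemma wh_ex p q : (p < n)%N -> (q <= n)%N -> exists j, @Wpt n j = wh p q.
Proof.
move=> pn qn; have h : (p * n.+1 + q < n * n.+1)%N by nia.
exists (Ordinal h).
by rewrite /Wpt /wh /= divnMDl // modnMDl divn_small ?modn_small ?addn0.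
Qed.

Lemma bl_ex s t : (s <= n)%N -> (t < n)%N -> exists i, @Bpt n i = bl s t.
Proof.
move=> sn tn; have h : (s * n + t < n * n.+1)%N by nia.
have n0 : (0 < n)%N by lia.
exists (Ordinal h).
by rewrite /Bpt /bl /= divnMDl // modnMDl divn_small ?modn_small ?addn0.
Qed.

Lemma Kinv_pt al be j i : Kinv n al be (Wpt j) (Bpt i) = invmx (Kmat n al be) j i.
Proof.
rewrite /Kinv (big_pred1 j) => [|k]; last by rewrite (inj_eq Wpt_inj).
by rewrite (big_pred1 i) // => k; rewrite (inj_eq Bpt_inj).
Qed.

(* The edges of the diamond are partitioned into the n^2 four-cycles around
   the points (2i+1, 2j+1); on the (i, j)-th one K is cw i j times
   [[i, 1], [1, i]], with rows the black vertices (i, j), (i+1, j) and columns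
   the white vertices (i, j), (i, j+1). *)
Definition cw al be (i j : nat) : C := if odd (i + j) then be else al.

Lemma cw_sym al be i j : cw al be i j = cw al be j i.
Proof. by rewrite /cw addnC. Qed.

(** The class of the black vertex is the parity of [s + t], whereas [cw] uses that of [p + t]. For
    [s = p + 1] the two differ, and this is exactly the exchange of the weights in the entries at x
    + e2 and x - e1. *)
Lemma KentE al be s t p q :
  Kent al be (bl s t) (wh p q) =
  cw al be p t *
   ((s == p)%:R * ((q == t)%:R * 'i + (q == t.+1)%:R)
    + (s == p.+1)%:R * ((q == t)%:R + (q == t.+1)%:R * 'i)).
Proof.
have Ee : ((s.*2 + t.*2.+1) %% 4 == 3)%N = odd (s + t).
  have [] : (odd (s + t) -> exists k, s + t = k.*2.+1)%N /\
            (~~ odd (s + t) -> exists k, s + t = k.*2)%N.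
    split=> h; exists (s+t)./2; first by rewrite -[LHS]odd_double_half h.
    by rewrite -[LHS]odd_double_half (negbTE h).
  case: (odd _) => [/(_ isT) [k hk] _|_ /(_ isT) [k hk]]; apply/eqP; lia.
rewrite /Kent /bl /wh /cw /= Ee.
have E1 : (p.*2.+1 == s.*2.+1) = (s == p) by lia.
have E2 : (p.*2.+2 == s.*2) = (s == p.+1) by lia.
have E3 : (q.*2 == t.*2.+2) = (q == t.+1) by lia.
have E4 : (t.*2.+1 == q.*2.+1) = (q == t) by lia.
have E5 : (s.*2 == p.*2.+2) = (s == p.+1) by lia.
rewrite E1 E2 E3 E4 E5.
case: (eqVneq s p) => [->|sp].
  have -> : (p == p.+1) = false by lia.
  case: (eqVneq q t.+1) => [->|qt] /=.
    have -> : (t.+1 == t) = false by lia.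
    by case: (odd _) => /=; ring.
  by case: (q == t); case: (odd _) => /=; ring.
case: (eqVneq s p.+1) => [->|sp'] /=; last by ring.
case: (eqVneq q t.+1) => [->|qt] /=.
  have -> : (t.+1 == t) = false by lia.
  by case: (odd _) => /=; ring.
by case: (q == t); case: (odd _) => /=; ring.
Qed.

(** Every edge lies in exactly one four-cycle, so the bilinear form of K is a sum of 2x2 forms. All
    later uses of K pass through this identity, with different test functions on the two sides. *)
Lemma city_sum al be (g h : nat -> nat -> C) :
  \sum_(s < n.+1) \sum_(t < n) g s t *
     (\sum_(p < n) \sum_(q < n.+1) Kent al be (bl s t) (wh p q) * h p q) =
  \sum_(p < n) \sum_(t < n) cw al be p t *
     (g p t * ('i * h p t + h p t.+1) + g p.+1 t * (h p t + 'i * h p t.+1)).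
Proof.
pose H p t s := (s == p :> nat)%:R * (cw al be p t * (g p t * ('i * h p t + h p t.+1)))
   + (s == p.+1 :> nat)%:R * (cw al be p t * (g p.+1 t * (h p t + 'i * h p t.+1))).
transitivity (\sum_(s < n.+1) \sum_(t < n) \sum_(p < n) H p t s).
  apply: eq_bigr => s _; apply: eq_bigr => t _; rewrite mulr_sumr.
  apply: eq_bigr => p _; rewrite mulr_sumr /H.
  transitivity (\sum_(q < n.+1) (
     (q == t :> nat)%:R * (g s t * cw al be p t * ((s == p :> nat)%:R * 'i + (s == p.+1
         :> nat)%:R) * h p q)
   + (q == t.+1 :> nat)%:R * (g s t * cw al be p t * ((s == p :> nat)%:R + (s == p.+1
       :> nat)%:R * 'i) * h p q))).
    by apply: eq_bigr => q _; rewrite KentE; ring.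
  rewrite big_split /=.
  rewrite (sum_delta _ n.+1 t (fun q => g s t * cw al be p t * ((s == p :> nat)%:R * 'i
      + (s == p.+1 :> nat)%:R) * h p q)).
  rewrite (sum_delta _ n.+1 t.+1 (fun q => g s t * cw al be p t * ((s == p :> nat)%:R +
      (s == p.+1 :> nat)%:R * 'i) * h p q)).
  rewrite !ltnS (ltnW (ltn_ord t)) ltn_ord.
  case: (eqVneq (s : nat) p) => [->|sp].
    have -> : (p == p.+1 :> nat) = false by lia.
    by rewrite /=; ring.
  by case: (eqVneq (s : nat) p.+1) => [->|sp'] /=; ring.
rewrite exchange_big /= [RHS]exchange_big /=; apply: eq_bigr => t _.
rewrite exchange_big /=; apply: eq_bigr => p _.
rewrite /H big_split /=.
rewrite (sum_delta C n.+1 p (fun=> cw al be p t * (g p t * ('i * h p t + h p t.+1)))).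
rewrite (sum_delta C n.+1 p.+1 (fun=> cw al be p t * (g p.+1 t * (h p t + 'i * h p t.+1)))).
by rewrite !ltnS (ltnW (ltn_ord p)) ltn_ord mulr1n; ring.
Qed.

End Points.
Arguments cw {C}.

(* Eliminating u from the equations of the n^2 four-cycles leaves, for the
   interior values of v, the same system on a diamond of size n - 1, again
   with positive weights (urban renewal). *)
Lemma diamond_kernel (C : numClosedFieldType) (n : nat)
    (al be ga de u v : nat -> nat -> C) :
  (forall i j, 0 < al i j) -> (forall i j, 0 < be i j) ->
  (forall i j, 0 < ga i j) -> (forall i j, 0 < de i j) ->
  (forall j, (j < n)%N -> v 0%N j = 0) -> (forall j, (j < n)%N -> v n j = 0) ->
  (forall i j, (i < n)%N -> (j < n)%N ->
     v i j = 'i * al i j * u i j + be i j * u i j.+1) ->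
  (forall i j, (i < n)%N -> (j < n)%N ->
     v i.+1 j = - (ga i j * u i j + 'i * de i j * u i j.+1)) ->
  forall i j, (i < n)%N -> (j <= n)%N -> u i j = 0.
Proof.
have ii : 'i * 'i = -1 :> C by rewrite -expr2 sqrCi.
elim: n al be ga de u v => [//|n IH] al be ga de u v al0 be0 ga0 de0 v0 vn vl vr.
(* [D] is the determinant of the four-cycle system giving [v i j] and [v i.+1 j] in terms of [u i j]
   and [u i j.+1]; positivity of the weights keeps it nonzero. *)
pose D i j := al i j * de i j + be i j * ga i j.
have D0 i j : D i j != 0 by rewrite gt_eqF // addr_gt0 // mulr_gt0.
have ub i j : (i < n.+1)%N -> (j < n.+1)%N ->
    D i j * u i j = - ('i * de i j * v i j + be i j * v i.+1 j).
  by move=> hi hj; rewrite vl // vr // /D; ring: ii.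
have ut i j : (i < n.+1)%N -> (j < n.+1)%N ->
    D i j * u i j.+1 = ga i j * v i j + 'i * al i j * v i.+1 j.
  by move=> hi hj; rewrite vl // vr // /D; ring: ii.
have vz i j : (i <= n.+1)%N -> (j < n.+1)%N -> v i j = 0.
  case: i => [|i] hi hj; first exact: v0.
  move: hi; rewrite ltnS leq_eqVlt => /orP [/eqP -> | hi]; first exact: vn.
  (* The value [u p q.+1] is given both by [ut] on cycle (p, q) and by [ub] on cycle (p, q+1).
     Equating the two yields a relation between rows p and p+1 of [v]; [v'] collects its terms from
     row p+1, so the terms from row p add up to [- v']. *)
  pose v' p q := 'i * (al p q / D p q) * v p.+1 q
               + be p q.+1 / D p q.+1 * v p.+1 q.+1.
  apply: (IH (fun p q => al p q / D p q) (fun p q => be p q.+1 / D p q.+1)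
     (fun p q => ga p.+1 q / D p.+1 q) (fun p q => de p.+1 q.+1 / D p.+1 q.+1)
     (fun p q => v p.+1 q) v') => //;
    try by move=> p q; rewrite divr_gt0 // addr_gt0 // mulr_gt0.
  - move=> q hq; have := ut 0%N q isT (ltnW hq); have := ub 0%N q.+1 isT hq.
    rewrite !v0 // ?mulr0 ?add0r /v'; last exact: ltnW.
    move=> e1 e2.
    have -> : be 0%N q.+1 / D 0%N q.+1 * v 1%N q.+1 = - u 0%N q.+1.
      by apply: (mulfI (D0 0%N q.+1)); rewrite mulrN e1 opprK; field; exact: D0.
    have -> : 'i * (al 0%N q / D 0%N q) * v 1%N q = u 0%N q.+1.
      by apply: (mulfI (D0 0%N q)); rewrite e2; field; exact: D0.
    by rewrite subrr.
  - by move=> q hq; rewrite /v' !vn ?mulr0 ?addr0 //; lia.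
  move=> p q hp hq.
  have e1 : D p.+1 q.+1 * u p.+1 q.+1 = - ('i * de p.+1 q.+1 * v p.+1 q.+1 + be p.+1
      q.+1 * v p.+2 q.+1).
    by apply: ub; lia.
  have e2 : D p.+1 q * u p.+1 q.+1 = ga p.+1 q * v p.+1 q + 'i * al p.+1 q * v p.+2 q.
    by apply: ut; lia.
  rewrite /v'; apply/eqP; rewrite -subr_eq0 opprK; apply/eqP.
  transitivity ((ga p.+1 q * v p.+1 q + 'i * al p.+1 q * v p.+2 q) / D p.+1 q
    + ('i * de p.+1 q.+1 * v p.+1 q.+1 + be p.+1 q.+1 * v p.+2 q.+1) / D p.+1 q.+1);
        first by ring.
  rewrite -e2 -[X in _ + X / _]opprK -e1 mulNr ![D _ _ * _]mulrC !mulfK //.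
  by rewrite subrr.
move=> i [|j] hi hj.
- by apply: (mulfI (D0 i 0%N)); rewrite ub // !vz ?mulr0 ?addr0 ?oppr0 // ltnW.
- by apply: (mulfI (D0 i j)); rewrite ut // !vz ?mulr0 ?addr0 // ltnW.
Qed.

Section Inverse.
Variables (C : numClosedFieldType) (n : nat) (al be : C).
Hypotheses (al0 : 0 < al) (be0 : 0 < be).

(** A row vector killed by K gives one equation per white vertex, balancing the contributions of the
    four-cycles above and below it. This is the system of [diamond_kernel], with the two coordinates
    exchanged. *)
Lemma Kmat_unit : Kmat n al be \in unitmx.
Proof.
rewrite -row_free_unit -kermx_eq0; apply/rowV0P => x /sub_kermxP xK.
pose g s t := \sum_(i | @Bpt n i == bl s t) x 0 i.
have gE i : x 0 i = g (i %/ n)%N (i %% n)%N.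
  rewrite /g (big_pred1 i) // => k.
  by rewrite -[bl _ _]/(Bpt i) (inj_eq (@Bpt_inj n)).
(* No black vertex has second index n, so [g] extends there by 0; this supplies the boundary
   condition on the side x2 = 2n. *)
have gn s : g s n = 0.
  apply: big1 => i /eqP [_ /double_inj e].
  have n0 : (0 < n)%N by have := ltn_ord i; lia.
  by have := ltn_mod i n; rewrite e ltnn n0.
have bilg (h : nat -> nat -> C) :
   \sum_(p < n) \sum_(t < n) cw al be p t *
     (g p t * ('i * h p t + h p t.+1) + g p.+1 t * (h p t + 'i * h p t.+1)) = 0.
  rewrite -(city_sum C n al be g h).
  transitivity ((x *m Kmat n al be *m \col_j h (j %/ n.+1)%N (j %% n.+1)%N) 0 0);
    last by rewrite xK mul0mx mxE.
  pose F s t := g s t * (\sum_(p < n) \sum_(q < n.+1) Kent al be (bl s t) (wh p q) * h p q).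
  rewrite -mulmxA mxE -(sum_divmod_swap n _ F) /F.
  apply: eq_bigr => i _; rewrite gE mxE; congr (_ * _).
  rewrite -(sum_divmod _ n n.+1 (fun p q => Kent al be (Bpt i) (wh p q) * h p q)).
  by apply: eq_bigr => j _; rewrite !mxE.
have cw0 i j : 0 < cw al be i j by rewrite /cw; case: ifP.
(* Testing [bilg] against the indicator of the white vertex (p, q). The boolean factors drop the
   cycle absent at either side, which also masks [q.-1] at q = 0. *)
have Wg p q : (p < n)%N -> (q <= n)%N ->
    (q < n)%N%:R * (cw al be p q * ('i * g p q + g p.+1 q))
    + (0 < q)%N%:R * (cw al be p q.-1 * (g p q.-1 + 'i * g p.+1 q.-1)) = 0.
  move=> pn qn.
  rewrite -[RHS](bilg (fun i j => (i == p)%:R * (j == q)%:R)).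
  transitivity (\sum_(i < n) (i == p :> nat)%:R * \sum_(j < n)
     ((j == q :> nat)%:R * (cw al be i j * ('i * g i j + g i.+1 j))
      + ((0 < q)%N && (j == q.-1 :> nat))%:R * (cw al be i j * (g i j + 'i * g i.+1 j)))).
    rewrite (sum_delta C n p (fun i => \sum_(j < n) ((j == q :> nat)%:R * (cw al be i j
        * ('i * g i j + g i.+1 j))
      + ((0 < q)%N && (j == q.-1 :> nat))%:R * (cw al be i j * (g i j + 'i * g i.+1 j))))).
    rewrite pn mul1r big_split /= (sum_delta C n q (fun j => cw al be p j * ('i * g p j
        + g p.+1 j))); congr (_ + _).
    case: q qn => [|q] qn /=; first by rewrite big1 // => *; rewrite !mul0r.
    by rewrite (sum_delta C n q (fun j => cw al be p j * (g p j + 'i * g p.+1 j))) qn.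
  apply: eq_bigr => i _; rewrite mulr_sumr; apply: eq_bigr => j _.
  have -> : (j.+1 == q) = ((0 < q)%N && (j == q.-1 :> nat)).
    by case: q {qn} => [|q] //=.
  by ring.
apply/rowP => i; rewrite gE mxE.
have n0 : (0 < n)%N by case: n i => // -[].
apply: (@diamond_kernel C n (fun i j => cw al be j i) (fun i j => cw al be j i) (fun i
    j => cw al be j i) (fun i j => cw al be j i)
  (fun i j => g j i) (fun i j => cw al be j i * ('i * g j i + g j.+1 i))) => //.
- by move=> j hj; have := Wg j 0%N hj isT; rewrite n0 mul0r addr0 mul1r.
- by move=> j hj; rewrite !gn mulr0 addr0 mulr0.
- by move=> p q hp hq; ring.
- move=> p q hp hq; have /= := Wg q p.+1 hq hp.
  rewrite mul1r; case: ltnP => [h|h].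
    by rewrite mul1r => /eqP; rewrite addr_eq0 => /eqP ->; ring.
  have -> : p.+1 = n by lia.
  rewrite mul0r add0r !gn mulr0 addr0 mulr0 => e.
  by apply/esym/eqP; rewrite oppr_eq0 -e; apply/eqP; ring.
- by rewrite ltn_mod.
- by rewrite -ltnS ltn_divLR //; have := ltn_ord i; lia.
Qed.

Definition Kco (p q s t : nat) : C := Kinv n al be (wh p q) (bl s t).

Lemma Kmat_Kinv s t s' t' : (s <= n)%N -> (t < n)%N -> (s' <= n)%N -> (t' < n)%N ->
  \sum_(p < n) \sum_(q < n.+1) Kent al be (bl s t) (wh p q) * Kco p q s' t'
  = ((s == s') && (t == t'))%:R.
Proof.
move=> sn tn sn' tn'; have [i Ei] := bl_ex n s t sn tn; have [k Ek] := bl_ex n s' t'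
    sn' tn'.
have := mulmxV Kmat_unit => /matrixP /(_ i k); rewrite !mxE.
rewrite -(inj_eq (@Bpt_inj n)) Ei Ek xpair_eqE.
have -> : (s.*2 == s'.*2) = (s == s') by lia.
have -> : (t.*2.+1 == t'.*2.+1) = (t == t') by lia.
move=> <-; rewrite -(sum_Wpt n _ (fun x => Kent al be (bl s t) x * Kinv n al be x (bl
    s' t'))).
by apply: eq_bigr => j _; rewrite mxE Ei -Kinv_pt Ek.
Qed.

Lemma Kinv_Kmat p q p' q' : (p < n)%N -> (q <= n)%N -> (p' < n)%N -> (q' <= n)%N ->
  \sum_(s < n.+1) \sum_(t < n) Kco p q s t * Kent al be (bl s t) (wh p' q')
  = ((p == p') && (q == q'))%:R.
Proof.
move=> pn qn pn' qn'; have [i Ei] := wh_ex n p q pn qn; have [k Ek] := wh_ex n p' q'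
    pn' qn'.
have := mulVmx Kmat_unit => /matrixP /(_ i k); rewrite !mxE.
rewrite -(inj_eq (@Wpt_inj n)) Ei Ek xpair_eqE.
have -> : (p.*2.+1 == p'.*2.+1) = (p == p') by lia.
have -> : (q.*2 == q'.*2) = (q == q') by lia.
move=> <-; rewrite -(sum_Bpt n _ (fun y => Kinv n al be (wh p q) y * Kent al be y (wh
    p' q'))).
by apply: eq_bigr => j _; rewrite mxE Ek -Kinv_pt Ei.
Qed.

(** A right inverse [Q] is the inverse: the product of [Kco], K and [Q] is bracketed in both ways. A
    symmetry of the inverse can thus be proved by checking K [Q] = 1 alone. *)
Lemma Kco_unique (Q : nat -> nat -> nat -> nat -> C) :
  (forall s t s' t', (s <= n)%N -> (t < n)%N -> (s' <= n)%N -> (t' < n)%N ->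
    \sum_(p < n) \sum_(q < n.+1) Kent al be (bl s t) (wh p q) * Q p q s' t'
    = ((s == s') && (t == t'))%:R) ->
  forall p q s t, (p < n)%N -> (q <= n)%N -> (s <= n)%N -> (t < n)%N ->
  Kco p q s t = Q p q s t.
Proof.
move=> KQ p q s t pn qn sn tn.
transitivity (\sum_(s' < n.+1) \sum_(t' < n) \sum_(p' < n) \sum_(q' < n.+1)
   Kco p q s' t' * Kent al be (bl s' t') (wh p' q') * Q p' q' s t).
  transitivity (\sum_(s' < n.+1) (s' == s :> nat)%:R * \sum_(t' < n) (t' == t :>
      nat)%:R * Kco p q s' t').
    rewrite (sum_delta C n.+1 s (fun s' => \sum_(t' < n) (t' == t :> nat)%:R * Kco p q
        s' t')).
    by rewrite (sum_delta C n t (fun t' => Kco p q s t')) ltnS sn tn !mul1r.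
  apply: eq_bigr => s' _; rewrite mulr_sumr; apply: eq_bigr => t' _.
  transitivity (Kco p q s' t' * \sum_(p' < n) \sum_(q' < n.+1)
      Kent al be (bl s' t') (wh p' q') * Q p' q' s t).
    by rewrite KQ ?leq_ord // mulrA -natrM mulnb mulrC.
  rewrite mulr_sumr; apply: eq_bigr => p' _; rewrite mulr_sumr.
  by apply: eq_bigr => q' _; rewrite mulrA.
under eq_bigr => s' _ do rewrite exchange_big /=.
rewrite exchange_big /=.
transitivity (\sum_(p' < n) (p' == p :> nat)%:R * \sum_(q' < n.+1) (q' == q :> nat)%:R
    * Q p' q' s t); last first.
  rewrite (sum_delta C n p (fun p' => \sum_(q' < n.+1) (q' == q :> nat)%:R * Q p' q' s t)).
  by rewrite (sum_delta C n.+1 q (fun q' => Q p q' s t)) ltnS qn pn !mul1r.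
apply: eq_bigr => p' _; rewrite mulr_sumr.
under eq_bigr => s' _ do rewrite exchange_big /=.
rewrite exchange_big /=; apply: eq_bigr => q' _.
transitivity ((\sum_(s' < n.+1) \sum_(t' < n) Kco p q s' t' * Kent al be (bl s' t') (wh
    p' q'))
   * Q p' q' s t).
  by rewrite mulr_suml; apply: eq_bigr => s' _; rewrite mulr_suml.
rewrite Kinv_Kmat ?leq_ord // mulrA -natrM mulnb.
by rewrite (eq_sym p) (eq_sym q).
Qed.

End Inverse.
Arguments Kco {C}.

(** * Summation by parts and the boundary terms *)

Lemma sum_by_parts (R : pzRingType) (n : nat) (al be h : nat -> R) :
  \sum_(j < n) (al j * h j + be j.+1 * h j.+1) =
  \sum_(j < n.+1) (al j + be j) * h j - be 0%N * h 0%N - al n * h n.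
Proof.
elim: n => [|n IH]; first by rewrite big_ord0 big_ord1 mulrDl addrK subrr.
rewrite big_ord_recr IH [in RHS]big_ord_recr /= mulrDl.
set S := \sum_(i < _) _; rewrite [RHS]addrAC (addrC (al n.+1 * _)) addrA addrK.
by rewrite addrA subrK addrAC.
Qed.

Section Boundary.
Variables (C : numClosedFieldType) (n : nat) (a w1 w2 : C).
Hypotheses (w1n0 : w1 != 0) (w2n0 : w2 != 0).

(* The adjoint of K applied to the monomials w1^x1 w2^x2 over the whole
   lattice, at the black vertex (2s, 2t+1). *)
Definition adj_mon (s t : nat) : C :=
  w1 ^+ s.*2 * w2 ^+ t.*2 *
  (cw a 1 s t * (w1 * (w2 ^+ 2 - 'i)) + cw 1 a s t * (w1^-1 * (1 - 'i * w2 ^+ 2))).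

(** [lo] and [up] are the coefficients that a white vertex receives from the four-cycle above and
    the one below it. Their sum is [cpart] times the monomial. The vertices j = 0 lack [up] and the
    vertices j = n lack [lo], which produces [s0] and [s2n]. *)
Let lo (i j : nat) : C := cw a 1 i j * w1 ^+ (i.*2).+1 * w2 ^+ j.*2 *
  (2 * cw a 1 i j + cw 1 a i j * (w1 ^- 2 * ('i + w2 ^+ 2) + w1 ^+ 2 * (w2 ^+ 2 - 'i))).
Let up (i j : nat) : C := cw 1 a i j * w1 ^+ (i.*2).+1 * w2 ^+ j.*2 *
  (2 * cw 1 a i j + cw a 1 i j * (w1 ^- 2 * (w2 ^- 2 - 'i) + w1 ^+ 2 * (w2 ^- 2 + 'i))).

Lemma adj_mon_sum (h : nat -> nat -> C) : ~~ odd n ->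
  \sum_(p < n) \sum_(t < n) cw a 1 p t *
     (adj_mon p t * ('i * h p t + h p t.+1) + adj_mon p.+1 t * (h p t + 'i * h p t.+1)) =
  cpart a w1 w2 * (\sum_(p < n) \sum_(q < n.+1) w1 ^+ (p.*2).+1 * w2 ^+ q.*2 * h p q)
  + \sum_(p < n) w1 ^+ (p.*2).+1 *
     (s0 a (odd p) w1 w2 * h p 0%N + s2n n a (odd p) w1 w2 * h p n).
Proof.
move=> n_even; have ii : 'i ^+ 2 = -1 :> C by rewrite sqrCi.
rewrite mulr_sumr -big_split; apply: eq_bigr => p _ /=.
transitivity (\sum_(t < n) (lo p t * h p t + up p t.+1 * h p t.+1)).
  apply: eq_bigr => t _; rewrite /lo /up /adj_mon /cw addSn addnS /= !doubleS !exprS.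
  by case: (odd (p + t)) => /=; field: ii; rewrite w1n0 w2n0.
rewrite (sum_by_parts _ n (lo p) (up p) (h p)) -addrA; congr (_ + _).
  rewrite mulr_sumr; apply: eq_bigr => q _; rewrite mulrA; congr (_ * _).
  rewrite /lo /up /cpart /cw !exprS.
  by case: (odd (p + q)) => /=; field; rewrite w1n0 w2n0.
rewrite /lo /up /s0 /s2n /cw addn0 oddD (negbTE n_even) addbF !exprS.
(* As n is even, the weight at j = n depends on the parity of p only, as it does at j = 0. *)
by case: (odd p) => /=; rewrite ?muln0 ?muln1 ?subn0 ?subnn /=; field; rewrite w1n0 w2n0.
Qed.

End Boundary.
Arguments adj_mon {C}.

(** With k divisible by 4, the class of the vertex with odd coordinate 2i+1 is the parity of i, so
    the two classes together enumerate all i. *)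
Lemma sum_mod4_class (V : nmodType) (n k : nat) (F : nat -> nat -> V) : (4 %| k)%N ->
  \sum_(eps < 2) \sum_(x < n.*2 | odd x && ((x + k) %% 4 == eps.*2.+1)%N) F eps x =
  \sum_(i < n) F (odd i) i.*2.+1.
Proof.
move=> /dvdnP [c ->].
transitivity (\sum_(eps < 2) \sum_(i < n) if odd i == (eps == 1 :> nat) then F eps
    i.*2.+1 else 0).
  apply: eq_bigr => eps _; rewrite big_mkcond /=.
  rewrite (sum_pairs _ n (fun x => if odd x && ((x + c * 4) %% 4 == eps.*2.+1)%N then F
      eps x else 0)).
  apply: eq_bigr => i _; rewrite /= odd_double /= add0r.
  have -> : ((i.*2.+1 + c * 4) %% 4 == eps.*2.+1)%N = (odd i == (eps == 1 :> nat)) => //.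
  have := ltn_ord eps; have := odd_double_half i.
  by case: (odd i) => hi he; apply/eqP/eqP; lia.
rewrite exchange_big /=; apply: eq_bigr => i _.
by rewrite big_ord_recl big_ord1 /=; case: (odd i); rewrite /= ?addr0 ?add0r.
Qed.

(** * The generating function *)

Section Generating.
Variables (C : numClosedFieldType) (n : nat) (a w1 w2 b1 b2 : C).
Hypotheses (a0 : 0 < a) (n_even : ~~ odd n).
Hypotheses (w1n0 : w1 != 0) (w2n0 : w2 != 0) (b1n0 : b1 != 0) (b2n0 : b2 != 0).
Hypotheses (cwn0 : cpart a w1 w2 != 0) (cbn0 : cpart a b1 b2 != 0).

Let P := Kco n a 1.
Let H p q := \sum_(s < n.+1) \sum_(t < n) P p q s t * (b1 ^+ s.*2 * b2 ^+ t.*2.+1).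

Lemma G_coord :
  G n a w1 w2 b1 b2 =
  \sum_(p < n) \sum_(q < n.+1) w1 ^+ p.*2.+1 * w2 ^+ q.*2 * H p q.
Proof.
pose F (x : nat * nat) := w1 ^+ x.1 * w2 ^+ x.2 *
  \sum_(s < n.+1) \sum_(t < n) Kinv n a 1 x (bl s t) * (b1 ^+ s.*2 * b2 ^+ t.*2.+1).
rewrite -(sum_Wpt n _ F); apply: eq_bigr => x _; rewrite /F.
pose F' (y : nat * nat) := Kinv n a 1 (Wpt x) y * (b1 ^+ y.1 * b2 ^+ y.2).
rewrite -(sum_Bpt n _ F') mulr_sumr; apply: eq_bigr => y _.
by rewrite /F' Kinv_pt; ring.
Qed.

(** The form of K between [adj_mon] and [H] is evaluated twice: by [adj_mon_sum], and through K K^-1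
    = 1, which turns K applied to [H] into the monomial in b1, b2. *)
Lemma white_side :
  cpart a w1 w2 * G n a w1 w2 b1 b2 =
  \sum_(s < n.+1) \sum_(t < n) adj_mon a w1 w2 s t * (b1 ^+ s.*2 * b2 ^+ t.*2.+1)
  - \sum_(p < n) w1 ^+ (p.*2).+1 *
     (s0 a (odd p) w1 w2 * H p 0%N + s2n n a (odd p) w1 w2 * H p n).
Proof.
rewrite G_coord; apply/eqP; rewrite -subr_eq opprK -adj_mon_sum //.
rewrite -city_sum; apply/eqP.
apply: eq_bigr => s _; apply: eq_bigr => t _; congr (_ * _).
transitivity (\sum_(s' < n.+1) \sum_(t' < n)
  (\sum_(p < n) \sum_(q < n.+1) Kent a 1 (bl s t) (wh p q) * P p q s' t') *
   (b1 ^+ s'.*2 * b2 ^+ t'.*2.+1)).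
  transitivity (\sum_(p < n) \sum_(q < n.+1) \sum_(s' < n.+1) \sum_(t' < n)
    Kent a 1 (bl s t) (wh p q) * P p q s' t' * (b1 ^+ s'.*2 * b2 ^+ t'.*2.+1)).
    apply: eq_bigr => p _; apply: eq_bigr => q _; rewrite /H mulr_sumr.
    apply: eq_bigr => s' _; rewrite mulr_sumr.
    by apply: eq_bigr => t' _; rewrite mulrA.
  rewrite [RHS]pair_bigA [LHS]pair_bigA /=.
  under eq_bigr => i _ do rewrite pair_bigA.
  rewrite exchange_big /=; apply: eq_bigr => j _.
  rewrite mulr_suml [RHS](eq_bigr (fun p : 'I_n => \sum_(q < n.+1) Kent a 1 (bl s t)
      (wh p q) * P p q j.1 j.2 * (b1 ^+ j.1.*2 * b2 ^+ j.2.*2.+1))).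
    by rewrite pair_bigA.
  by move=> p _; rewrite mulr_suml.
transitivity (\sum_(s' < n.+1) (s' == s :> nat)%:R * \sum_(t' < n) (t' == t :> nat)%:R *
    (b1 ^+ s'.*2 * b2 ^+ t'.*2.+1)); last first.
  rewrite (sum_delta C n.+1 s (fun s' => \sum_(t' < n) (t' == t :> nat)%:R * (b1 ^+
      s'.*2 * b2 ^+ t'.*2.+1))).
  by rewrite (sum_delta C n t (fun t' => b1 ^+ s.*2 * b2 ^+ t'.*2.+1)) !ltn_ord !mul1r.
apply: eq_bigr => s' _; rewrite mulr_sumr; apply: eq_bigr => t' _.
by rewrite Kmat_Kinv ?ltr01 ?leq_ord // [RHS]mulrA -natrM mulnb (eq_sym (s : nat))
    (eq_sym (t : nat)).
Qed.

(** The transpose of [white_side] at one white vertex. Symmetry of the four-cycle matrix lets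
    [adj_mon_sum] serve again, with b2, b1 as variables and the indices exchanged. *)
Lemma black_side p q : (p < n)%N -> (q <= n)%N ->
  cpart a b1 b2 * H p q =
  adj_mon a b2 b1 q p
  - \sum_(t < n) b2 ^+ (t.*2).+1 *
     (s0 a (odd t) b2 b1 * P p q 0%N t + s2n n a (odd t) b2 b1 * P p q n t).
Proof.
move=> pn qn; apply/eqP; rewrite -subr_eq opprK; apply/eqP.
have -> : cpart a b1 b2 = cpart a b2 b1 by rewrite /cpart; ring.
have -> : H p q = \sum_(t < n) \sum_(s < n.+1) b2 ^+ (t.*2).+1 * b1 ^+ s.*2 * P p q s t.
  rewrite /H exchange_big; apply: eq_bigr => t _; apply: eq_bigr => s _ /=; ring.
rewrite -(adj_mon_sum C n a b2 b1 b2n0 b1n0 (fun t s => P p q s t)) //.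
transitivity (\sum_(s < n.+1) \sum_(t < n) P p q s t *
   \sum_(p' < n) \sum_(q' < n.+1) Kent a 1 (bl s t) (wh p' q') * adj_mon a b2 b1 q' p').
  rewrite (city_sum C n a 1 (P p q) (fun p' q' => adj_mon a b2 b1 q' p')) exchange_big /=.
  by apply: eq_bigr => t _; apply: eq_bigr => s _; rewrite (cw_sym C a 1 s t); ring.
transitivity (\sum_(p' < n) \sum_(q' < n.+1)
  (\sum_(s < n.+1) \sum_(t < n) P p q s t * Kent a 1 (bl s t) (wh p' q')) * adj_mon a
      b2 b1 q' p').
  transitivity (\sum_(s < n.+1) \sum_(t < n) \sum_(p' < n) \sum_(q' < n.+1)
     P p q s t * Kent a 1 (bl s t) (wh p' q') * adj_mon a b2 b1 q' p').
    apply: eq_bigr => s _; apply: eq_bigr => t _; rewrite mulr_sumr.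
    apply: eq_bigr => p' _; rewrite mulr_sumr.
    by apply: eq_bigr => t' _; rewrite mulrA.
  rewrite [RHS]pair_bigA [LHS]pair_bigA /=.
  under eq_bigr => i _ do rewrite pair_bigA.
  rewrite exchange_big /=; apply: eq_bigr => j _.
  rewrite mulr_suml [RHS](eq_bigr (fun s : 'I_n.+1 => \sum_(t < n) P p q s t * Kent a 1
      (bl s t) (wh j.1 j.2) * adj_mon a b2 b1 j.2 j.1)).
    by rewrite pair_bigA.
  by move=> s _; rewrite mulr_suml.
transitivity (\sum_(p' < n) (p' == p :> nat)%:R * \sum_(q' < n.+1) (q' == q :> nat)%:R *
    adj_mon a b2 b1 q' p').
  apply: eq_bigr => p' _; rewrite mulr_sumr; apply: eq_bigr => q' _.
  by rewrite Kinv_Kmat ?ltr01 ?leq_ord // [RHS]mulrA -natrM mulnb (eq_sym p) (eq_sym q).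
rewrite (sum_delta C n p (fun p' => \sum_(q' < n.+1) (q' == q :> nat)%:R * adj_mon a b2
    b1 q' p')).
by rewrite (sum_delta C n.+1 q (fun q' => adj_mon a b2 b1 q' p)) ltnS pn qn !mul1r.
Qed.

Let r := n./2.

(** The weights have period 2 in p, so consecutive pairs form a geometric sum of ratio w1^4 b1^4. *)
Lemma side_sum :
  \sum_(p < n) w1 ^+ (p.*2).+1 *
     (s0 a (odd p) w1 w2 * adj_mon a b2 b1 0 p + s2n n a (odd p) w1 w2 * adj_mon a b2
         b1 n p) =
  dsides n a w1 w2 b1 b2 * fgeo r (w1 ^+ 4 * b1 ^+ 4).
Proof.
pose F p := w1 ^+ (p.*2).+1 *
     (s0 a (odd p) w1 w2 * adj_mon a b2 b1 0 p + s2n n a (odd p) w1 w2 * adj_mon a b2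
         b1 n p).
have nE : n = r.*2 by rewrite -[LHS](odd_double_half n) (negbTE n_even).
transitivity (\sum_(p < r.*2) F p); first by rewrite -nE.
rewrite sum_pairs /fgeo mulr_sumr; apply: eq_bigr => j _.
rewrite /F /dsides /= odd_double /=.
(* The exponent is an integer, so the splitting also holds for n = 0. *)
have -> : b2 ^ ((n.*2)%:Z - 1) = b2 ^+ n.*2 * b2^-1 by rewrite expfzDr.
rewrite /adj_mon /cw !oddD /= !odd_double (negbTE n_even) /=.
rewrite exprMn -!exprM !doubleS !mulSn -!muln2 !mul0n !exprS.
set S0 := s0 _ _ _ _; set S1 := s0 _ _ _ _; set T0 := s2n _ _ _ _ _; set T1 := s2n _ _
    _ _ _.
have -> : (j * 2 * 2 = 4 * j)%N by lia.
by field.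
Qed.

Lemma bulk_sum :
  \sum_(s < n.+1) \sum_(t < n) adj_mon a w1 w2 s t * (b1 ^+ s.*2 * b2 ^+ t.*2.+1) =
  fgeo r (w2 ^+ 4 * b2 ^+ 4) * fgeo r (w1 ^+ 4 * b1 ^+ 4) * b2 * w1
    * (a + w1 ^+ 2 * b1 ^+ 2 + w2 ^+ 2 * b2 ^+ 2 * (1 + a * w1 ^+ 2 * b1 ^+ 2))
    * (w2 ^+ 2 + b1 ^+ 2 - 'i * (1 + w2 ^+ 2 * b1 ^+ 2))
  + ((1 - 'i * w2 ^+ 2) * w1 ^-1 * b2 * (1 + a * w2 ^+ 2 * b2 ^+ 2)
     + (w2 ^+ 2 - 'i) * w1 ^+ (n.*2).+1 * b1 ^+ (n.*2) * b2 * (a + w2 ^+ 2 * b2 ^+ 2))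
    * fgeo r (w2 ^+ 4 * b2 ^+ 4).
Proof.
have nE : n = r.*2 by rewrite -[LHS](odd_double_half n) (negbTE n_even).
set fW := fgeo r (w1 ^+ 4 * b1 ^+ 4); set fV := fgeo r (w2 ^+ 4 * b2 ^+ 4).
pose E := w1 * (w2 ^+ 2 - 'i); pose F := w1^-1 * (1 - 'i * w2 ^+ 2).
pose v := w2 ^+ 2 * b2 ^+ 2; pose u := w1 ^+ 2 * b1 ^+ 2.
pose X0 := (a + v) * E + (1 + a * v) * F; pose X1 := (1 + a * v) * E + (a + v) * F.
(* Pairing consecutive t gives the factor [fV]; [X0] and [X1] are the pair sums for even and odd s.
   The sum over s has an odd number of terms: the last one, s = 2r, stays alone and is the source of
   the factor w1^(2n+1) b1^(2n). *)
transitivity (\sum_(s < r.*2.+1) u ^+ s * (b2 * fV * (if odd s then X1 else X0))).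
  rewrite -nE; apply: eq_bigr => s _.
  pose Fs t := adj_mon a w1 w2 s t * (b1 ^+ s.*2 * b2 ^+ t.*2.+1).
  transitivity (\sum_(t < r.*2) Fs t); first by rewrite -nE.
  rewrite sum_pairs.
  rewrite /fV /fgeo mulr_sumr mulr_suml mulr_sumr; apply: eq_bigr => t _.
  have -> : u ^+ s = w1 ^+ s.*2 * b1 ^+ s.*2 by rewrite /u exprMn -!exprM mul2n.
  have -> : (w2 ^+ 4 * b2 ^+ 4) ^+ t = w2 ^+ t.*2.*2 * b2 ^+ t.*2.*2.
    by rewrite exprMn -!exprM -!mul2n mulnA.
  rewrite /Fs /adj_mon /cw !oddD /= odd_double addbF /X0 /X1 -/E -/F /v !doubleS !exprS.
  by case: (odd s) => /=; ring.
have geo : fW * (1 - u ^+ 2) = 1 - u ^+ r.*2.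
  rewrite /fW /fgeo.
  have -> : w1 ^+ 4 * b1 ^+ 4 = u ^+ 2 by rewrite /u; ring.
  by apply: oppr_inj; rewrite -mulrN !opprB -mul2n exprM [RHS]subrX1 mulrC.
rewrite big_ord_recr /= odd_double.
rewrite (sum_pairs _ r (fun s => u ^+ s * (b2 * fV * (if odd s then X1 else X0)))).
have -> : \sum_(j < r) (u ^+ j.*2 * (b2 * fV * (if odd j.*2 then X1 else X0)) +
    u ^+ j.*2.+1 * (b2 * fV * (if odd j.*2.+1 then X1 else X0))) =
   fW * (b2 * fV * (X0 + u * X1)).
  rewrite /fW /fgeo mulr_suml; apply: eq_bigr => j _ /=; rewrite odd_double /=.
  have -> : w1 ^+ 4 * b1 ^+ 4 = u ^+ 2 by rewrite /u; ring.
  by rewrite -exprM mul2n exprS; ring.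
have -> x : x * w1 ^+ n.*2.+1 * b1 ^+ n.*2 = x * (w1 * u ^+ r.*2).
  by rewrite /u exprMn -!exprM mul2n -nE exprS; ring.
(* Once the power of [u] is eliminated in favour of [fW], a rational identity of fixed degree
   remains. *)
have -> : u ^+ r.*2 = 1 - fW * (1 - u ^+ 2) by rewrite geo; ring.
by rewrite /X0 /X1 /E /F /u /v; field.
Qed.

Lemma corner_sum :
  \sum_(eps < 2) \sum_(delta < 2)
     \sum_(k <- [:: 0%N; n.*2]) \sum_(l <- [:: 0%N; n.*2])
     \sum_(x1 < n.*2 | odd x1 && ((x1 + k) %% 4 == eps.*2.+1)%N)
     \sum_(y2 < n.*2 | odd y2 && ((l + y2) %% 4 == delta.*2.+1)%N)
       sfun n a eps k w1 w2 * sfun n a delta l b2 b1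
         * Kinv n a 1 (nat_of_ord x1, k) (l, nat_of_ord y2)
         / (cpart a w1 w2 * cpart a b1 b2)
         * w1 ^+ x1 * b2 ^+ y2 =
  (\sum_(p < n) w1 ^+ (p.*2).+1 *
    (s0 a (odd p) w1 w2 * (\sum_(t < n) b2 ^+ (t.*2).+1 *
       (s0 a (odd t) b2 b1 * P p 0 0 t + s2n n a (odd t) b2 b1 * P p 0 n t))
     + s2n n a (odd p) w1 w2 * (\sum_(t < n) b2 ^+ (t.*2).+1 *
       (s0 a (odd t) b2 b1 * P p n 0 t + s2n n a (odd t) b2 b1 * P p n n t))))
  / (cpart a w1 w2 * cpart a b1 b2).
Proof.
pose T (eps delta k l x y : nat) := sfun n a eps k w1 w2 * sfun n a delta l b2 b1
  * Kinv n a 1 (x, k) (l, y) / (cpart a w1 w2 * cpart a b1 b2) * w1 ^+ x * b2 ^+ y.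
(* Evenness of n makes 2n divisible by 4, so [sum_mod4_class] applies on all four sides. *)
have dvd4 k : k \in [:: 0%N; n.*2] -> (4 %| k)%N.
  rewrite !inE => /orP [] /eqP -> //.
  by rewrite -muln2 (@dvdn_mul 2 2) // dvdn2.
transitivity (\sum_(k <- [:: 0%N; n.*2]) \sum_(l <- [:: 0%N; n.*2])
    \sum_(p < n) \sum_(t < n) T (odd p) (odd t) k l p.*2.+1 t.*2.+1).
  under eq_bigr => eps _ do rewrite exchange_big /=.
  rewrite exchange_big /= [LHS]big_seq [RHS]big_seq; apply: eq_bigr => k /dvd4 k4.
  under eq_bigr => eps _ do rewrite exchange_big /=.
  rewrite exchange_big /= [LHS]big_seq [RHS]big_seq; apply: eq_bigr => l /dvd4 l4.
  under eq_bigr => eps _ do rewrite exchange_big /=.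
  rewrite (@sum_mod4_class _ n k (fun eps x => \sum_(delta < 2)
    \sum_(y < n.*2 | odd y && ((l + y) %% 4 == delta.*2.+1)%N) T eps delta k l x y)) //.
  apply: eq_bigr => p _.
  rewrite -(@sum_mod4_class _ n l (fun delta y => T (odd p) delta k l p.*2.+1 y)) //.
  by apply: eq_bigr => delta _; apply: eq_bigl => y; rewrite addnC.
rewrite !big_cons !big_nil !addr0 -!big_split mulr_suml; apply: eq_bigr => p _ /=.
rewrite !mulr_sumr -!big_split /= mulr_sumr mulr_suml; apply: eq_bigr => t _ /=.
(* The test in [sfun] separates k = 0 from k = 2n because some p < n exists; for n = 0 there are no
   terms. *)
have n2 : n.*2 == 0%N = false by have := ltn_ord p; lia.
by rewrite /T /sfun eqxx n2 /P /Kco /wh /bl double0; ring.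
Qed.

Lemma G_formula :
  G n a w1 w2 b1 b2 =
  dfun n a w1 w2 b1 b2 / cpart a w1 w2
  + \sum_(eps < 2) \sum_(delta < 2)
     \sum_(k <- [:: 0%N; n.*2]) \sum_(l <- [:: 0%N; n.*2])
     \sum_(x1 < n.*2 | odd x1 && ((x1 + k) %% 4 == eps.*2.+1)%N)
     \sum_(y2 < n.*2 | odd y2 && ((l + y2) %% 4 == delta.*2.+1)%N)
       sfun n a eps k w1 w2 * sfun n a delta l b2 b1
         * Kinv n a 1 (nat_of_ord x1, k) (l, nat_of_ord y2)
         / (cpart a w1 w2 * cpart a b1 b2)
         * w1 ^+ x1 * b2 ^+ y2.
Proof.
rewrite corner_sum; apply: (mulfI cwn0); rewrite white_side bulk_sum.
set T0 := (X in X / (cpart _ _ _ * cpart _ _ _)); set S := \sum_(p < n) _.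
(* [black_side] replaces [H] on the two white sides: its [adj_mon] part sums to [dsides] by
   [side_sum], its boundary part to the corner term [T0]. *)
have -> : S = (dsides n a w1 w2 b1 b2 * fgeo r (w1 ^+ 4 * b1 ^+ 4) - T0) / cpart a b1 b2.
  apply: (mulIf cbn0); rewrite divfK // -side_sum /T0 /S -sumrB mulr_suml.
  apply: eq_bigr => p _.
  transitivity (w1 ^+ p.*2.+1 * (s0 a (odd p) w1 w2 * (cpart a b1 b2 * H p 0%N)
    + s2n n a (odd p) w1 w2 * (cpart a b1 b2 * H p n))); first by ring.
  by rewrite !black_side //; ring.
by rewrite /dfun -/r; field; rewrite cwn0 cbn0.
Qed.

End Generating.

(** * Rotation and reflection of the diamond *)

Section Symmetry.
Variables (C : numClosedFieldType) (n : nat) (al be : C).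
Hypotheses (al0 : 0 < al) (be0 : 0 < be).

(** The rotation swaps both rows and columns of [[i, 1], [1, i]], which leaves it unchanged, and it
    preserves the parity of the cycle. *)
Lemma Kent_rotate s t p q : (s <= n)%N -> (t < n)%N -> (p < n)%N -> (q <= n)%N ->
  Kent al be (bl (n - s) (n - t.+1)) (wh (n - p.+1) (n - q)) = Kent al be (bl s t) (wh p q).
Proof.
move=> sn tn pn qn; rewrite !KentE.
have -> : (n - s == n - p.+1)%N = (s == p.+1) by lia.
have -> : (n - s == (n - p.+1).+1)%N = (s == p) by lia.
have -> : (n - q == n - t.+1)%N = (q == t.+1) by lia.
have -> : (n - q == (n - t.+1).+1)%N = (q == t) by lia.
have -> : cw al be (n - p.+1) (n - t.+1) = cw al be p t.
  rewrite /cw; have -> : odd (n - p.+1 + (n - t.+1)) = odd (p + t) by lia.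
  by [].
by ring.
Qed.

(** The reflection swaps only the rows, hence i with 1: the factor is -i on entries i and i on
    entries 1, and [s + t + p + q] is even exactly on the former. The sign splits into a black and a
    white one, so it is a gauge. *)
Lemma Kent_reflect s t p q : ~~ odd n ->
  (s <= n)%N -> (t < n)%N -> (p < n)%N -> (q <= n)%N ->
  Kent be al (bl (n - s) t) (wh (n - p.+1) q) =
  - 'i * (-1) ^+ (s + t + p + q) * Kent al be (bl s t) (wh p q).
Proof.
have ii : 'i ^+ 2 = -1 :> C by rewrite sqrCi.
move=> n_even sn tn pn qn; rewrite !KentE.
have -> : (n - s == n - p.+1)%N = (s == p.+1) by lia.
have -> : (n - s == (n - p.+1).+1)%N = (s == p) by lia.
have -> : cw be al (n - p.+1) t = cw al be p t.
  rewrite /cw; have -> : odd (n - p.+1 + t) = ~~ odd (p + t) by lia.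
  by case: odd.
rewrite -signr_odd !oddD.
case: (eqVneq s p) => [->|sp].
  have -> : (p == p.+1) = false by lia.
  case: (eqVneq q t.+1) => [->|qt] /=.
    have -> : (t.+1 == t) = false by lia.
    by case: (odd p); case: (odd t) => /=; ring: ii.
  case: (eqVneq q t) => [->|_] /=; last by ring.
  by case: (odd p); case: (odd t) => /=; ring: ii.
case: (eqVneq s p.+1) => [->|sp'] /=; last by ring.
case: (eqVneq q t.+1) => [->|qt] /=.
  have -> : (t.+1 == t) = false by lia.
  by case: (odd p); case: (odd t) => /=; ring: ii.
case: (eqVneq q t) => [->|_] /=; last by ring.
by case: (odd p); case: (odd t) => /=; ring: ii.
Qed.

Lemma Kco_rotate p q s t : (p < n)%N -> (q <= n)%N -> (s <= n)%N -> (t < n)%N ->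
  Kco n al be p q s t = Kco n al be (n - p.+1) (n - q) (n - s) (n - t.+1).
Proof.
move: p q s t; apply: (Kco_unique C n al be al0 be0 (fun p q s t => Kco n al be (n -
    p.+1) (n - q) (n - s) (n - t.+1))).
move=> s t s' t' sn tn sn' tn'.
have -> : (s == s') = (n - s == n - s')%N by lia.
have -> : (t == t') = (n - t.+1 == n - t'.+1)%N by lia.
rewrite -(Kmat_Kinv C n al be al0 be0) ?leq_subr //; try lia.
rewrite -[RHS](sum_rev _ n (fun p => \sum_(q < n.+1) Kent al be (bl (n - s) (n - t.+1))
    (wh p q) *
   Kco n al be p q (n - s') (n - t'.+1))).
apply: eq_bigr => p _.
rewrite -[RHS](sum_rev _ n.+1 (fun q => Kent al be (bl (n - s) (n - t.+1)) (wh (n -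
    p.+1) q) *
   Kco n al be (n - p.+1) q (n - s') (n - t'.+1))).
by apply: eq_bigr => q _; rewrite subSS Kent_rotate // leq_ord.
Qed.

Lemma Kco_reflect p q s t : ~~ odd n ->
  (p < n)%N -> (q <= n)%N -> (s <= n)%N -> (t < n)%N ->
  Kco n al be p q s t =
  - 'i * (-1) ^+ (p + q + s + t) * Kco n be al (n - p.+1) q (n - s) t.
Proof.
have ii : 'i ^+ 2 = -1 :> C by rewrite sqrCi.
move=> n_even; move: p q s t; apply: (Kco_unique C n al be al0 be0 (fun p q s t =>
  - 'i * (-1) ^+ (p + q + s + t) * Kco n be al (n - p.+1) q (n - s) t)).
move=> s t s' t' sn tn sn' tn'.
(* The white signs cancel in the product; the remaining black sign is 1 on the diagonal, the only
   place where it counts. *)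
transitivity ((-1) ^+ (s + t + s' + t') * ((n - s == n - s')%N && (t == t'))%:R : C);
    last first.
  have -> : (n - s == n - s')%N = (s == s') by lia.
  case: eqP => [->|_]; case: eqP => [->|_]; rewrite /= ?mulr0 //.
  by rewrite mulr1 -signr_odd -addnA addnn odd_double.
rewrite -(Kmat_Kinv C n be al be0 al0) ?leq_subr //.
rewrite -(sum_rev _ n (fun p => \sum_(q < n.+1) Kent be al (bl (n - s) t) (wh p q) *
   Kco n be al p q (n - s') t')).
rewrite mulr_sumr; apply: eq_bigr => p _; rewrite mulr_sumr; apply: eq_bigr => q _.
rewrite Kent_reflect ?leq_ord //.
have sg : (-1) ^+ (s + t + p + q) * (-1) ^+ (s + t + p + q) = 1 :> C.
  by rewrite -expr2 sqrr_sign.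
have -> : (-1) ^+ (p + q + s' + t') =
  (-1) ^+ (s + t + s' + t') * (-1) ^+ (s + t + p + q) :> C.
  by rewrite -exprD -signr_odd -[RHS]signr_odd; congr (_ ^+ nat_of_bool _); lia.
by ring: ii.
Qed.

End Symmetry.

Theorem theorem4 (C : numClosedFieldType) (m : nat) (a : C) :
  let n := (4 * m)%N in
  0 < a ->
  (forall w1 w2 b1 b2 : C,
     w1 != 0 -> w2 != 0 -> b1 != 0 -> b2 != 0 ->
     cpart a w1 w2 != 0 -> cpart a b1 b2 != 0 ->
     G n a w1 w2 b1 b2 =
       dfun n a w1 w2 b1 b2 / cpart a w1 w2
       + \sum_(eps < 2) \sum_(delta < 2)
           \sum_(k <- [:: 0%N; n.*2]) \sum_(l <- [:: 0%N; n.*2])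
           \sum_(x1 < n.*2 | odd x1 && ((x1 + k) %% 4 == eps.*2.+1)%N)
           \sum_(y2 < n.*2 | odd y2 && ((l + y2) %% 4 == delta.*2.+1)%N)
             sfun n a eps k w1 w2 * sfun n a delta l b2 b1
               * Kinv n a 1 (nat_of_ord x1, k) (l, nat_of_ord y2)
               / (cpart a w1 w2 * cpart a b1 b2)
               * w1 ^+ x1 * b2 ^+ y2)
  /\
  (forall x1 y2 : nat,
     odd x1 -> (x1 < n.*2)%N -> odd y2 -> (y2 < n.*2)%N ->
     [/\ Kinv n a 1 (x1, 0%N) (0%N, y2) = L n a 1 (x1.-1)./2 (y2.-1)./2,
         Kinv n a 1 (x1, 0%N) (n.*2, y2)
           = 'i ^+ (n.*2 - 1 - x1 + y2) * L n 1 a (n - (x1.+1)./2) (y2.-1)./2,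
         Kinv n a 1 (x1, n.*2) (0%N, y2)
           = 'i ^+ (n.*2 - 1 + x1 - y2) * L n 1 a (x1.-1)./2 (n - (y2.+1)./2)
       & Kinv n a 1 (x1, n.*2) (n.*2, y2)
           = L n a 1 (n - (x1.+1)./2) (n - (y2.+1)./2)]).
Proof.
move=> n a0; have n_even : ~~ odd n by rewrite /n oddM.
split=> [w1 w2 b1 b2 *|x1 y2]; first exact: G_formula.
move=> xo xn yo yn.
have [p Ep] : exists p, x1 = p.*2.+1 by exists x1./2; lia.
have [t Et] : exists t, y2 = t.*2.+1 by exists y2./2; lia.
have pn : (p < n)%N by lia.
have tn : (t < n)%N by lia.
rewrite {}Ep {}Et /= !doubleK {x1 y2 xo xn yo yn}.
(* The reflection carries the side x1 = 2n to x1 = 0 and exchanges the weights. The entries from x2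
   = 2n to x1 = 0 are first rotated into this case. *)
have right p' t' : (p' < n)%N -> (t' < n)%N ->
    Kco n a 1 p' 0 n t' = - 'i * (-1) ^+ (p' + t') * L n 1 a (n - p'.+1) t'.
  move=> pn' tn'; rewrite (Kco_reflect C n a 1 a0 ltr01) // subnn addn0.
  by rewrite addnAC -[_ ^+ (_ + n)]signr_odd oddD (negbTE n_even) addbF signr_odd.
have sign_i k : 'i ^+ k.*2.+1 = (-1) ^+ k * 'i :> C.
  by rewrite exprSr -mul2n exprM sqrCi.
split.
- by [].
- rewrite -[LHS]/(Kco n a 1 p 0 n t) right //.
  have -> : (n.*2 - 1 - p.*2.+1 + t.*2.+1 = (n - p.+1 + t).*2.+1)%N by lia.
  rewrite sign_i -[in RHS]signr_odd.
  (* This change of parity absorbs the minus sign of the factor -i. *)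
  have -> : odd (n - p.+1 + t) = ~~ odd (p + t) by lia.
  by rewrite signrN signr_odd; ring.
- rewrite -[LHS]/(Kco n a 1 p n 0 t) (Kco_rotate C n a 1 a0 ltr01) // subnn subn0.
  rewrite right; try lia.
  have -> : (n - (n - p.+1).+1 = p)%N by lia.
  (* The natural subtraction does not truncate, since t < n. *)
  have -> : (n.*2 - 1 + p.*2.+1 - t.*2.+1 = (n + p - t.+1).*2.+1)%N by lia.
  rewrite sign_i -[in RHS]signr_odd -[in LHS]signr_odd.
  have -> : odd (n + p - t.+1) = ~~ odd (n - p.+1 + (n - t.+1)) by lia.
  by rewrite signrN; ring.
by rewrite -[LHS]/(Kco n a 1 p n n t) (Kco_rotate C n a 1 a0 ltr01) // !subnn.
Qed.
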